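(* In the setting and notation of the context, let $c_5>0$ and suppose that every $u\in R_h$ can be decomposed as $$\mathtt{u}=\mathtt{v}+\mathtt{\Pi}\mathtt{z}+\mathtt{C}\mathtt{y}$$ with $z\in U_h\times U_h\times U_h$, $y\in N_h$ and $v\in R_h$ such that $$(\mathrm{diag}(\mathtt{D})\mathtt{v},\mathtt{v})+(\mathtt{D}\mathtt{\Pi}\mathtt{z},\mathtt{\Pi}\mathtt{z})+(\mathtt{D}\mathtt{C}\mathtt{y},\mathtt{C}\mathtt{y})\le c_5(\mathtt{D}\mathtt{u},\mathtt{u}).$$ Then any $q\in Q_h$ can be decomposed as $$\mathtt{q}=\mathtt{v}_f+\mathtt{\Pi}_{f\tilde f}\mathtt{z}_{\tilde f}+\mathtt{C}_{f\breve f}\mathtt{y}_{\breve f}$$ where $v\in R_h$, $z\in U_h^3$ and $y\in N_h$, and their interface degrees of freedom satisfy $$(\mathrm{diag}(\mathtt{S})\mathtt{v}_f,\mathtt{v}_f)+(\mathtt{S}\mathtt{\Pi}_{f\tilde f}\mathtt{z}_{\tilde f},\mathtt{\Pi}_{f\tilde f}\mathtt{z}_{\tilde f})+(\mathtt{S}\mathtt{C}_{f\breve f}\mathtt{y}_{\breve f},\mathtt{C}_{f\breve f}\mathtt{y}_{\breve f})\le c_5(\mathtt{S}\mathtt{q},\mathtt{q}).$$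
   Context: $\Omega\subset\mathbb{R}^3$ is a bounded polyhedral domain with Lipschitz boundary, partitioned by a finite element mesh $\Omega_h$. $R_h\subset H(\mathrm{div},\Omega)$ is the Raviart-Thomas space of order $p\ge1$ on $\Omega_h$ (on tetrahedra, $r|_K\in P_p(K)^3+xP_p(K)$ for all $K\in\Omega_h$, with $P_p(K)$ the polynomials of total degree at most $p$); $Q_h$ is the space of element-wise normal traces on element boundaries of functions in $R_h$. $U_h\subset H^1_0(\Omega)$ is a scalar Lagrange finite element space on $\Omega_h$, and $N_h$ is the $H(\mathrm{curl})$-conforming Nédélec space of the first kind on $\Omega_h$ corresponding to $R_h$ in the standard finite element exact sequence (so $\mathrm{curl}\,N_h\subset R_h$). Each space has a fixed standard basis, and a typewriter letter ($\mathtt{u},\mathtt{v},\mathtt{z},\mathtt{y},\mathtt{q}$) denotes the coefficient vector of the function with the same letter; $(\cdot,\cdot)$ between vectors is the Euclidean inner product. The degrees of freedom of $R_h$ are partitioned into those in element interiors ($i$) and those on element interfaces ($f$); those of $U_h^3$ into interior ($\tilde i$) and interface ($\tilde f$) ones; those of $N_h$ into interior ($\breve i$) and interface ($\breve f$) ones. Subscripts on vectors and matrices denote the corresponding sub-vectors and blocks. The basis of $Q_h$ consists of the normal traces of the interface basis functions of $R_h$, so $\mathtt{q}$ is indexed by $f$. $\mathtt{D}$ is the Gram matrix of the $H(\mathrm{div},\Omega)$ inner product $(\sigma,\tau)_{L^2}+(\mathrm{div}\,\sigma,\mathrm{div}\,\tau)_{L^2}$ in the basis of $R_h$, and $\mathtt{S}=\mathtt{D}_{ff}-\mathtt{D}_{fi}\mathtt{D}_{ii}^{-1}\mathtt{D}_{if}$.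 $\mathrm{diag}(\cdot)$ is the diagonal matrix formed from the diagonal of its argument. $\mathtt{\Pi}$ is the matrix of the Raviart-Thomas interpolation operator $U_h^3\to R_h$, and $\mathtt{C}$ is the matrix of $\mathrm{curl}:N_h\to R_h$, in the chosen bases. By the definition of the degrees of freedom, interface degrees of freedom of the image depend only on interface degrees of freedom of the argument: $$\mathtt{\Pi}=\begin{bmatrix}\mathtt{\Pi}_{i\tilde i}&\mathtt{\Pi}_{i\tilde f}\\0&\mathtt{\Pi}_{f\tilde f}\end{bmatrix},\qquad \mathtt{C}=\begin{bmatrix}\mathtt{C}_{i\breve i}&\mathtt{C}_{i\breve f}\\0&\mathtt{C}_{f\breve f}\end{bmatrix}.$$ *)

(* Defs.v *)
From mathcomp Require Import all_boot all_order all_algebra.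
From mathcomp Require Import all_classical all_reals all_analysis.
Set Implicit Arguments.
Unset Strict Implicit.
Unset Printing Implicit Defensive.
Import Order.TTheory GRing.Theory Num.Theory.
Import numFieldNormedType.Exports.
Local Open Scope classical_set_scope.
Local Open Scope ring_scope.

Notation pt R := 'rV[R]_3.

Definition dot (R : realType) (u v : pt R) : R := \sum_i u 0 i * v 0 i.

(* Addition in 'I_3 is modulo 3. *)
Definition cross (R : realType) (u v : pt R) : pt R :=
  \row_i (u 0 (i + 1) * v 0 (i + 2) - u 0 (i + 2) * v 0 (i + 1)).

Definition partial (R : realType) (i : 'I_3) (f : pt R -> R) (x : pt R) : R :=
  'D_(delta_mx 0 i) f x.

Definition div (R : realType) (w : pt R -> pt R) (x : pt R) : R :=
  \sum_i partial i (fun y => w y 0 i) x.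

Definition curl (R : realType) (w : pt R -> pt R) (x : pt R) : pt R :=
  \row_i (partial (i + 1) (fun y => w y 0 (i + 2)) x
          - partial (i + 2) (fun y => w y 0 (i + 1)) x).

Definition C1 (R : realType) (f : pt R -> R) : Prop :=
  (forall x, differentiable f x) /\ (forall i, continuous (partial i f)).

Definition C1v (R : realType) (w : pt R -> pt R) : Prop :=
  forall i, C1 (fun x => w x 0 i).

Definition point3 (R : realType) (t : R * R * R) : pt R :=
  \row_(i < 3) nth 0 [:: t.1.1; t.1.2; t.2] i.

Definition volume_integral (R : realType) (A : set (pt R)) (f : pt R -> R) : R :=
  \int[((@lebesgue_measure R \x @lebesgue_measure R) \x @lebesgue_measure R)%E]_(t in
    @point3 R @^-1` A) f (point3 t).

Definition hull (R : realType) (V : seq (pt R)) : set (pt R) :=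
  [set x | exists c : 'I_(size V) -> R,
    [/\ forall i, 0 <= c i, \sum_i c i = 1 & x = \sum_i c i *: V`_i]].

(* The boundary is locally the graph of a Lipschitz function, with the domain
   on one side of it, in the orthonormal frame given by the rows of Q. *)
Definition lipschitz_boundary (R : realType) (Omega : set (pt R)) : Prop :=
  forall x0, (closure Omega `\` Omega) x0 ->
  exists (Q : 'M[R]_3) (r h L : R) (gamma : 'rV[R]_2 -> R),
  [/\ Q *m Q^T = 1%:M, 0 < r, 0 < h,
      forall a b, `|gamma a - gamma b| <= L * `|a - b|
    & forall (a : 'rV[R]_2) (t : R), `|a| < r -> `|t| < h ->
      let x := x0 + row_mx a (t%:M : 'rV[R]_1) *m Q in
      (Omega x <-> t < gamma a) /\
      ((closure Omega `\` Omega) x <-> t = gamma a)].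

Record polyhedral_domain (R : realType) (Omega : set (pt R)) : Prop := {
  domain_open : open Omega;
  domain_connected : connected Omega;
  domain_nonempty : Omega !=set0;
  domain_bounded : bounded_set Omega;
  domain_polyhedral : exists s : seq (seq (pt R)),
    closure Omega = [set x | exists2 V, V \in s & hull V x];
  domain_lipschitz : lipschitz_boundary Omega }.

(* Faces of all dimensions of a convex polytope, including set0 and P. *)
Definition is_face (R : realType) (F P : set (pt R)) : Prop :=
  exists (n : pt R) (c : R),
    (forall x, P x -> dot n x <= c) /\ F = P `&` [set x | dot n x = c].

(* F is a two-dimensional face of P with outward unit normal n. *)
Definition facet (R : realType) (P : set (pt R)) (n : pt R) (F : set (pt R)) :
    Prop :=
  [/\ dot n n = 1,
      exists c : R,
        (forall x, P x -> dot n x <= c) /\ F = P `&` [set x | dot n x = c]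
    & exists a b c : pt R,
        [/\ F a, F b, F c & cross (b - a) (c - a) != 0]].

Definition is_tetrahedron (R : realType) (P : set (pt R)) : Prop :=
  exists a b c d : pt R,
    dot (cross (b - a) (c - a)) (d - a) != 0 /\ P = hull [:: a; b; c; d].

(* Cells are closed convex polytopes of any shape. *)
Record mesh (R : realType) (Omega : set (pt R)) (T : finType)
    (cell : T -> set (pt R)) : Prop := {
  cell_polytope : forall e, exists V, cell e = hull V;
  cell_solid : forall e, interior (cell e) !=set0;
  cell_cover : closure Omega = \bigcup_e cell e;
  cell_disjoint : forall e e', e != e' ->
    interior (cell e) `&` interior (cell e') = set0;
  cell_conforming : forall e e',
    is_face (cell e `&` cell e') (cell e) /\
    is_face (cell e `&` cell e') (cell e') }.

(* A function on a closed cell P is represented by its extension by 0 outside P.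
   A family indexed by the cells can be two-valued on interfaces; element-wise
   derivatives are only used in the interiors of the cells. *)

Definition scalar_fun (R : realType) (T : finType) := T -> pt R -> R.
Definition vector_fun (R : realType) (T : finType) := T -> pt R -> pt R.

Definition on_cell (R : realType) (Y : nmodType) (P : set (pt R))
  (f : pt R -> Y) : pt R -> Y := patch (fun=> 0) P f.

Definition pwC1 (R : realType) (T : finType) (cell : T -> set (pt R))
    (v : T -> pt R -> pt R) : Prop :=
  forall e, exists2 w, C1v w & v e = on_cell (cell e) w.

Definition poly_le (R : realType) (p : nat) : set (pt R -> R) :=
  [set f | exists c : {ffun 'I_3 -> 'I_p.+1} -> R,
    f = fun x : pt R => \sum_(a : {ffun 'I_3 -> 'I_p.+1} | (\sum_i a i <= p)%N)
                   c a * \prod_i x 0 i ^+ a i].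

Definition poly_le3 (R : realType) (p : nat) : set (pt R -> pt R) :=
  [set w | forall i, poly_le p (fun x => w x 0 i)].

Definition RT_tet (R : realType) (p : nat) (P : set (pt R)) :
    set (pt R -> pt R) :=
  [set r | exists a b, [/\ poly_le3 p a, poly_le p b
    & r = on_cell P (fun x => a x + b x *: x)]].

(* First kind: P_p^3 + x `cross` P_p^3. *)
Definition Nedelec_tet (R : realType) (p : nat) (P : set (pt R)) :
    set (pt R -> pt R) :=
  [set w | exists a b, [/\ poly_le3 p a, poly_le3 p b
    & w = on_cell P (fun x => a x + cross x (b x))]].

Definition Lagrange_tet (R : realType) (k : nat) (P : set (pt R)) :
    set (pt R -> R) :=
  [set u | exists2 a, poly_le k a & u = on_cell P a].

Definition subspace (R : realType) (E : lmodType R) (V : set E) : Prop :=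
  V 0 /\ forall a f g, V f -> V g -> V (a *: f + g).

(* The local Raviart-Thomas, Nedelec and Lagrange spaces.  They are prescribed
   on tetrahedra; on cells of other shapes (where they depend on the element
   family and on the mapping of the reference cell) any spaces of C^1 functions
   with curl VN included in VR are allowed. *)
Record local_spaces (R : realType) (T : finType) (cell : T -> set (pt R))
    (p k : nat) (VR VN : T -> set (pt R -> pt R)) (VU : T -> set (pt R -> R)) :
    Prop := {
  VR_tet : forall e, is_tetrahedron (cell e) -> VR e = RT_tet p (cell e);
  VN_tet : forall e, is_tetrahedron (cell e) -> VN e = Nedelec_tet p (cell e);
  VU_tet : forall e, is_tetrahedron (cell e) -> VU e = Lagrange_tet k (cell e);
  VR_sub : forall e, subspace (VR e);
  VN_sub : forall e, subspace (VN e);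
  VU_sub : forall e, subspace (VU e);
  VR_C1 : forall e r, VR e r -> exists2 g, C1v g & r = on_cell (cell e) g;
  VN_C1 : forall e w, VN e w -> exists2 g, C1v g & w = on_cell (cell e) g;
  VU_C1 : forall e u, VU e u -> exists2 g, C1 g & u = on_cell (cell e) g;
  curl_VN : forall e w, VN e w -> exists2 r, VR e r &
    forall x, interior (cell e) x -> curl w x = r x }.

(* H(div)-conformity: normal components agree across interfaces. *)
Definition Rh (R : realType) (T : finType) (cell : T -> set (pt R))
    (VR : T -> set (pt R -> pt R)) : set (vector_fun R T) :=
  [set r | (forall e, VR e (r e)) /\
    (forall e e' n F, facet (cell e) n F -> facet (cell e') (- n) F ->
      forall x, F x -> dot n (r e x) = dot n (r e' x))].

(* H(curl)-conformity: tangential components agree across interfaces. *)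
Definition Nh (R : realType) (T : finType) (cell : T -> set (pt R))
    (VN : T -> set (pt R -> pt R)) : set (vector_fun R T) :=
  [set w | (forall e, VN e (w e)) /\
    (forall e e' n F, facet (cell e) n F -> facet (cell e') (- n) F ->
      forall x, F x -> cross n (w e x) = cross n (w e' x))].

(* H^1_0-conformity: continuity, and zero values on the boundary of Omega. *)
Definition Uh (R : realType) (Omega : set (pt R)) (T : finType)
    (cell : T -> set (pt R)) (VU : T -> set (pt R -> R)) :
    set (scalar_fun R T) :=
  [set u | [/\ forall e, VU e (u e),
      forall e e' x, cell e x -> cell e' x -> u e x = u e' x
    & forall e x, cell e x -> (closure Omega `\` Omega) x -> u e x = 0]].

Definition Uh3 (R : realType) (Omega : set (pt R)) (T : finType)
    (cell : T -> set (pt R)) (VU : T -> set (pt R -> R)) :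
    set (vector_fun R T) :=
  [set z | forall d, Uh Omega cell VU (fun e x => z e x 0 d)].

(* The element-wise normal trace: its value at e, n, x is that of r . n at
   the point x of the facet of the cell e with outward unit normal n. *)
Definition ntrace (R : realType) (T : finType) (cell : T -> set (pt R))
    (r : vector_fun R T) : T -> pt R -> pt R -> R :=
  fun e n x =>
    if `[< exists2 F, facet (cell e) n F & F x >] then dot n (r e x) else 0.

Definition Qh (R : realType) (T : finType) (cell : T -> set (pt R))
    (VR : T -> set (pt R -> pt R)) : set (T -> pt R -> pt R -> R) :=
  ntrace cell @` Rh cell VR.

Definition lincomb (R : realType) (E : lmodType R) (m : nat) (b : 'I_m -> E)
  (c : 'cV[R]_m) : E := \sum_j c j 0 *: b j.

Definition is_basis (R : realType) (E : lmodType R) (V : set E) (m : nat)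
    (b : 'I_m -> E) : Prop :=
  [/\ forall j, V (b j),
      forall s, V s -> exists c, s = lincomb b c
    & forall c, lincomb b c = 0 -> c = 0].

Definition coef (R : realType) (E : lmodType R) (m : nat) (b : 'I_m -> E)
  (s : E) : 'cV[R]_m := xget 0 [set c | s = lincomb b c].

Definition zero_normal_trace (R : realType) (T : finType)
    (cell : T -> set (pt R)) (r : vector_fun R T) : Prop :=
  forall e n F, facet (cell e) n F -> forall x, F x -> dot n (r e x) = 0.

Definition zero_tangential_trace (R : realType) (T : finType)
    (cell : T -> set (pt R)) (w : vector_fun R T) : Prop :=
  forall e n F, facet (cell e) n F -> forall x, F x -> cross n (w e x) = 0.

Definition zero_trace (R : realType) (T : finType)
    (cell : T -> set (pt R)) (z : vector_fun R T) : Prop :=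
  forall e n F, facet (cell e) n F -> forall x, F x -> z e x = 0.

(* The first mi basis functions are the interior ones, the last mf ones the
   interface ones: interior basis functions are those whose (normal, tangential
   or full) trace vanishes on all element boundaries. *)
Definition interior_interface (E : Type) (bubble : E -> Prop) (mi mf : nat)
    (b : 'I_(mi + mf) -> E) : Prop :=
  (forall i : 'I_mi, bubble (b (lshift mf i))) /\
  (forall j : 'I_mf, ~ bubble (b (rshift mi j))).

(* Degrees of freedom of R_h (moments or point values, say), dual to the basis
   phi: interior ones only see the field in one element, interface ones only its
   normal component on one facet. *)
Record RT_dofs (R : realType) (T : finType) (cell : T -> set (pt R))
    (ri rf : nat) (phi : 'I_(ri + rf) -> vector_fun R T)
    (dof : 'I_(ri + rf) -> vector_fun R T -> R) : Prop := {
  dof_linear : forall j a v w, pwC1 cell v -> pwC1 cell w ->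
    dof j (a *: v + w) = a * dof j v + dof j w;
  dof_dual : forall j l, dof j (phi l) = (j == l)%:R;
  dof_interior : forall i : 'I_ri, exists e, forall v w,
    pwC1 cell v -> pwC1 cell w -> v e = w e ->
    dof (lshift rf i) v = dof (lshift rf i) w;
  dof_interface : forall j : 'I_rf, exists e n F, facet (cell e) n F /\
    forall v w, pwC1 cell v -> pwC1 cell w ->
      (forall x, F x -> dot n (v e x) = dot n (w e x)) ->
      dof (rshift ri j) v = dof (rshift ri j) w }.

Definition RT_interpolation (R : realType) (T : finType) (m : nat)
    (phi : 'I_m -> vector_fun R T) (dof : 'I_m -> vector_fun R T -> R)
    (z : vector_fun R T) : vector_fun R T :=
  \sum_j dof j z *: phi j.

Definition is_RT_interpolation_matrix (R : realType) (T : finType) (m n : nat)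
    (phi : 'I_m -> vector_fun R T) (dof : 'I_m -> vector_fun R T -> R)
    (zeta : 'I_n -> vector_fun R T) (Pi : 'M[R]_(m, n)) : Prop :=
  forall l, RT_interpolation phi dof (zeta l) = lincomb phi (col l Pi).

Definition is_curl_matrix (R : realType) (T : finType)
    (cell : T -> set (pt R)) (m n : nat) (phi : 'I_m -> vector_fun R T)
    (psi : 'I_n -> vector_fun R T) (C : 'M[R]_(m, n)) : Prop :=
  forall l e x, interior (cell e) x ->
    curl (psi l e) x = lincomb phi (col l C) e x.

Definition hdiv (R : realType) (T : finType) (cell : T -> set (pt R))
    (s t : vector_fun R T) : R :=
  (\sum_e volume_integral (interior (cell e)) (fun x => dot (s e x) (t e x))) +
  (\sum_e volume_integral (interior (cell e))
            (fun x => div (s e) x * div (t e) x)).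

Definition gram (R : realType) (T : finType) (cell : T -> set (pt R)) (m : nat)
    (phi : 'I_m -> vector_fun R T) : 'M[R]_m :=
  \matrix_(i, j) hdiv cell (phi j) (phi i).

Definition schur (R : realType) (mi mf : nat) (D : 'M[R]_(mi + mf)) : 'M[R]_mf :=
  drsubmx D - dlsubmx D *m invmx (ulsubmx D) *m ursubmx D.

Definition diag_of (R : realType) (m : nat) (A : 'M[R]_m) : 'M[R]_m :=
  diag_mx (\row_i A i i).

Definition ip (R : realType) (m : nat) (x y : 'cV[R]_m) : R :=
  \sum_i x i 0 * y i 0.

(* Main.v *)
Require Import Defs.
From mathcomp Require Import all_boot all_order all_algebra.
From mathcomp Require Import all_classical all_reals all_analysis.
From mathcomp Require Import ring lra.
Import Order.TTheory GRing.Theory Num.Theory.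
Import numFieldNormedType.Exports.
Local Open Scope classical_set_scope.
Local Open Scope ring_scope.
Set Implicit Arguments.
Unset Strict Implicit.
Unset Printing Implicit Defensive.

(* Given q, the assumed decomposition is applied to the discrete extension u of
   q, which has interface part q and minimal energy, so that (D u, u) = (S q, q).
   Since Pi and C are block triangular, the interface part of the decomposition
   of u is a decomposition of q.  The energies on the left only decrease: the
   Schur complement energy of the interface part of a vector is at most the
   energy of the vector, and on unit vectors this gives diag S <= diag D_ff.

   Three facts come from the finite element setting: D_ii is invertible, as the
   H(div) inner product is definite; an interior function of U_h^3 vanishes on
   the facets seen by the interface degrees of freedom; and a field with zero
   tangential trace on a facet has a curl with zero normal component there. *)

(** * Schur complements *)

Lemma ipE (R : realType) (m : nat) (x y : 'cV[R]_m) : ip x y = (x^T *m y) 0 0.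
Proof. by rewrite mxE; apply: eq_bigr => i _; rewrite mxE. Qed.

Lemma ipDl (R : realType) (m : nat) (x x' y : 'cV[R]_m) :
  ip (x + x') y = ip x y + ip x' y.
Proof. by rewrite !ipE linearD mulmxDl mxE. Qed.

Lemma ipDr (R : realType) (m : nat) (x y y' : 'cV[R]_m) :
  ip x (y + y') = ip x y + ip x y'.
Proof. by rewrite !ipE mulmxDr mxE. Qed.

Lemma ip_col_mx (R : realType) (m n : nat) (x x' : 'cV[R]_m) (y y' : 'cV[R]_n) :
  ip (col_mx x y) (col_mx x' y') = ip x x' + ip y y'.
Proof. by rewrite !ipE tr_col_mx mul_row_col mxE. Qed.

Lemma ipC (R : realType) (m : nat) (x y : 'cV[R]_m) : ip x y = ip y x.
Proof. by apply: eq_bigr => i _; rewrite mulrC. Qed.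

Lemma ip_symmetric (R : realType) (m : nat) (D : 'M[R]_m) (x y : 'cV[R]_m) :
  D^T = D -> ip (D *m x) y = ip (D *m y) x.
Proof. by move=> symD; rewrite ipC !ipE trmx_mul symD mulmxA. Qed.

Lemma ip_delta (R : realType) (m : nat) (D : 'M[R]_m) (j : 'I_m) :
  ip (D *m delta_mx j 0) (delta_mx j 0) = D j j.
Proof.
rewrite /ip (bigD1 j)//= big1 ?addr0 => [|i /negbTE ij]; last first.
  by rewrite [delta_mx j 0 i 0]mxE ij mulr0.
rewrite -colE !mxE !eqxx mulr1//.
Qed.

Lemma ip_diag_of (R : realType) (m : nat) (D : 'M[R]_m) (v : 'cV[R]_m) :
  ip (diag_of D *m v) v = \sum_i D i i * v i 0 ^+ 2.
Proof. by apply: eq_bigr => i _; rewrite mul_diag_mx !mxE -mulrA. Qed.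

Section SchurComplement.
Context {R : realType} {mi mf : nat} {D : 'M[R]_(mi + mf)}.
Hypothesis D_sym : D^T = D.
Hypothesis D_ge0 : forall c, 0 <= ip (D *m c) c.
Hypothesis Dii_unit : ulsubmx D \in unitmx.

(** The interior part solves [ulsubmx D *m x + ursubmx D *m q = 0], so [D] times the extension has
    no interior component. *)
Definition discrete_extension (q : 'cV[R]_mf) : 'cV[R]_(mi + mf) :=
  col_mx (- (invmx (ulsubmx D) *m ursubmx D *m q)) q.

Lemma mul_discrete_extension (q : 'cV[R]_mf) :
  D *m discrete_extension q = col_mx 0 (schur D *m q).
Proof.
rewrite -{1}(submxK D) mul_block_col !mulmxN -mulmxA mulKVmx// addNr.
by rewrite addrC /schur mulmxBl !mulmxA.
Qed.

Lemma energy_discrete_extension (q : 'cV[R]_mf) :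
  ip (D *m discrete_extension q) (discrete_extension q) = ip (schur D *m q) q.
Proof.
rewrite mul_discrete_extension ip_col_mx [ip 0 _]big1 ?add0r// => i _.
by rewrite mxE mul0r.
Qed.

(** Pythagoras in the energy: [c] is the discrete extension of its interface part plus a
    [D]-orthogonal vector of nonnegative energy. *)
Lemma schur_energy_le (c : 'cV[R]_(mi + mf)) :
  ip (schur D *m dsubmx c) (dsubmx c) <= ip (D *m c) c.
Proof.
(* e is a bubble, hence D-orthogonal to discrete extensions. *)
set q := dsubmx c; pose e := c - discrete_extension q.
have e_bubble : e = col_mx (usubmx e) 0.
  rewrite -[LHS]vsubmxK; congr col_mx.
  by rewrite linearB /= col_mxKd subrr.
have De0 : ip (D *m discrete_extension q) e = 0.
  rewrite mul_discrete_extension e_bubble ip_col_mx /ip.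
  rewrite [X in X + _]big1 ?add0r => [|i _]; last by rewrite mxE mul0r.
  by rewrite big1 => [|i _]; last by rewrite [(0 : 'cV_mf) i 0]mxE mulr0.
have cE : c = discrete_extension q + e by rewrite addrC subrK.
clearbody e; rewrite [in leRHS]cE mulmxDr ipDl !ipDr De0.
rewrite (ip_symmetric e (discrete_extension q) D_sym) De0 addr0 add0r.
by rewrite energy_discrete_extension lerDl.
Qed.

(** Diagonal entries are energies of unit vectors, so [schur_energy_le] compares them one by one;
    the interior terms on the right are nonnegative. *)
Lemma schur_diag_le (v : 'cV[R]_(mi + mf)) :
  ip (diag_of (schur D) *m dsubmx v) (dsubmx v) <= ip (diag_of D *m v) v.
Proof.
rewrite !ip_diag_of big_split_ord /= -[leLHS]add0r; apply: lerD.
  by apply: sumr_ge0 => i _; rewrite mulr_ge0 ?sqr_ge0// -ip_delta.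
apply: ler_sum => j _; rewrite [dsubmx v j 0]mxE ler_wpM2r ?sqr_ge0//.
rewrite -(ip_delta (schur D)) -(ip_delta D).
have <- : dsubmx (delta_mx (rshift mi j) 0 : 'cV[R]_(mi + mf)) = delta_mx j 0.
  by apply/matrixP => i l; rewrite !mxE (inj_eq (@rshift_inj _ _)).
exact: schur_energy_le.
Qed.

End SchurComplement.

Lemma dsubmx_mul_block_triangular (R : realType) (mi mf ni nf : nat)
    (A : 'M[R]_(mi + mf, ni + nf)) (x : 'cV[R]_(ni + nf)) :
  dlsubmx A = 0 -> dsubmx (A *m x) = drsubmx A *m dsubmx x.
Proof.
move=> A0; rewrite -{1}(submxK A) -{1}(vsubmxK x) mul_block_col col_mxKd A0.
by rewrite mul0mx add0r.
Qed.

(** * Volume integrals *)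

Lemma sum_ord3 (R : nmodType) (F : 'I_3 -> R) :
  \sum_i F i = F 0 + F 1 + F (1 + 1).
Proof.
rewrite !big_ord_recl big_ord0 addr0 addrA.
by congr (_ + F _ + F _); exact: val_inj.
Qed.

(** Evaluates the shifts modulo 3 in [cross] and [curl], with the third index written [1 + 1] as in
    [sum_ord3] and [ord3P]. *)
Lemma ord3_cycle :
  ((0 + 1 = 1 :> 'I_3)%R * (0 + 2 = 1 + 1 :> 'I_3)%R * (1 + 2 = 0 :> 'I_3)%R *
   (1 + 1 + 1 = 0 :> 'I_3)%R * (1 + 1 + 2 = 1 :> 'I_3)%R)%type.
Proof. by do !split; exact: val_inj. Qed.

Lemma ord3P (P : 'I_3 -> Prop) : P 0 -> P 1 -> P (1 + 1) -> forall i, P i.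
Proof.
move=> P0 P1 P2 [[|[|[|//]]] i3].
- by rewrite (_ : Ordinal i3 = 0)//; exact: val_inj.
- by rewrite (_ : Ordinal i3 = 1)//; exact: val_inj.
- by rewrite (_ : Ordinal i3 = 1 + 1)//; exact: val_inj.
Qed.

Notation volume3 R :=
  ((@lebesgue_measure R \x @lebesgue_measure R) \x @lebesgue_measure R)%E.
Notation triple R :=
  (measurableTypeR R * measurableTypeR R * measurableTypeR R)%type.

Lemma ball_rV3 (R : realType) (x y : pt R) (e : R) : 0 < e ->
  ball x e y <-> forall i, `|x 0 i - y 0 i| < e.
Proof.
move=> e0; split=> [[_ xy] i|xy]; first exact: xy.
by split => // i j; rewrite (ord1 i); exact: xy.
Qed.

(** The norm on row vectors is the maximum norm, so a ball is a cube, that is, a product of three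
    intervals. *)
Lemma point3_ball (R : realType) (x : pt R) (e : R) : 0 < e ->
  @point3 R @^-1` ball x e =
  (ball (x 0 0) e `*` ball (x 0 1) e) `*` ball (x 0 (1 + 1)) e.
Proof.
move=> e0; apply/seteqP; split=> -[[a b] c] /=.
  move=> /(ball_rV3 _ _ e0) xt.
  by split; [split|]; [have := xt 0|have := xt 1|have := xt (1 + 1)];
    rewrite mxE.
move=> [[xa xb] xc]; apply/(ball_rV3 _ _ e0).
by apply: ord3P; rewrite mxE.
Qed.

Lemma measurable_point3_ball (R : realType) (x : pt R) (e : R) : 0 < e ->
  measurable (@point3 R @^-1` ball x e : set (triple R)).
Proof.
move=> e0; rewrite point3_ball//.
by apply: measurableX; [apply: measurableX|]; exact: measurable_realfun.measurable_ball.
Qed.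

Lemma volume3_ball (R : realType) (x : pt R) (e : R) : 0 < e ->
  volume3 R (@point3 R @^-1` ball x e) = ((e *+ 2) ^+ 3)%:E.
Proof.
move=> e0; rewrite point3_ball//.
have mb y : measurable (ball y e : set (measurableTypeR R)).
  exact: measurable_realfun.measurable_ball.
rewrite product_measure1E//; last exact: measurableX.
rewrite /= product_measure1E//.
transitivity ((e *+ 2)%:E * (e *+ 2)%:E * (e *+ 2)%:E)%E.
  by congr (_ * _ * _)%E; apply: lebesgue_measure_ball; exact: ltW.
by rewrite !exprS expr0 mulr1 mulrA.
Qed.

(** An open set is the union of the countably many cubes inside it with rational centre and radius
    [1 / (n + 1)]. *)
Lemma measurable_point3_open (R : realType) (A : set (pt R)) : open A ->
  measurable (@point3 R @^-1` A : set (triple R)).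
Proof.
move=> oA.
pose c (q : 'rV[rat]_3) : pt R := map_mx ratr q.
(* Balls that leave [A] are replaced by [set0], so that the union can run over a whole countable
   type. *)
pose F (qn : 'rV[rat]_3 * nat) : set (pt R) :=
  if `[< ball (c qn.1) qn.2.+1%:R^-1 `<=` A >] then ball (c qn.1) qn.2.+1%:R^-1
  else set0.
have -> : A = \bigcup_qn F qn.
  apply/seteqP; split=> [x Ax|x [qn _]]; last first.
    by rewrite /F; case: asboolP => // + xb; apply.
  have /nbhs_ballP[e /= e0 xeA] : nbhs x A by move: oA; rewrite openE; exact.
  (* Half of [e], because a ball of radius [d] that contains [x] is only known to lie in
     [ball x (d + d)]. *)
  have [n ne] : exists n : nat, n.+1%:R^-1 < e / 2.
    have e2 : 0 < e / 2 by rewrite divr_gt0.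
    have [n _ /(_ n (leqnn _)) nP] := near_infty_natSinv_lt (PosNum e2).
    by exists n.
  have : 0 < n.+1%:R^-1 :> R by rewrite invr_gt0.
  move: ne; set d : R := n.+1%:R^-1 => de d0.
  have qP i : exists q : rat, `|ratr q - x 0 i| < d.
    have : x 0 i - d < x 0 i + d by lra.
    move=> /rat_in_itvoo[q]; rewrite in_itv /= => /andP[q1 q2].
    by exists q; rewrite ltr_distl q1.
  pose q : 'rV[rat]_3 := \row_i projT1 (cid (qP i)).
  have qx : ball (c q) d x by apply/ball_rV3 => // i; rewrite !mxE; case: cid.
  exists (q, n) => //; rewrite /F /=; case: asboolP => // -[].
  move=> y qy; apply: xeA; apply: (@le_ball _ _ _ (d + d)); first by lra.
  by apply: (ball_triangle _ qy); exact: ball_sym.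
rewrite preimage_bigcup; apply: countable_bigcupT_measurable => // qn.
rewrite /F; case: asboolP => _; last by rewrite preimage_set0.
by apply: measurable_point3_ball; rewrite invr_gt0.
Qed.

Lemma continuous_point3_measurable (R : realType) (f : pt R -> R)
    (D : set (triple R)) :
  measurable D -> continuous f -> measurable_fun D (f \o @point3 R).
Proof.
move=> mD /continuousP cf.
apply: (measurability (@measurable_realfun.RGenOpens.G R)).
  exact: measurable_realfun.RGenOpens.measurableE.
move=> _ [_ [a [b ->]] <-]; apply: measurableI => //.
rewrite comp_preimage; apply: measurable_point3_open; apply: cf.
exact: interval_open.
Qed.

(** A continuous function is bounded on the compact closure of [A], and [A] has finite volume
    because it lies in a ball. *)
Lemma continuous_point3_integrable (R : realType) (A : set (pt R))
    (f : pt R -> R) :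
  open A -> bounded_set A -> continuous f ->
  (volume3 R).-integrable (@point3 R @^-1` A) (EFin \o (f \o @point3 R)).
Proof.
move=> oA bA cf.
have [r r0 Ar] : exists2 r : R, 0 < r & A `<=` ball 0 r.
  have [M [_ AM]] := bA; have M0 : 0 <= `|M| by [].
  exists (`|M| + 2); first by lra.
  move=> x Ax; rewrite -ball_normE /ball_/= sub0r normrN.
  have : `|x| <= `|M| + 1 by apply: AM => //; have := ler_norm M; lra.
  by lra.
apply: measurable_bounded_integrable => [|||].
- exact: measurable_point3_open.
- apply: (@le_lt_trans _ _ (volume3 R (@point3 R @^-1` ball 0 r))).
    apply: le_measure; rewrite ?inE.
    + exact: measurable_point3_open.
    + exact: measurable_point3_ball.
    + exact: preimage_subset.
  by rewrite volume3_ball// ltry.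
- by apply: continuous_point3_measurable => //; exact: measurable_point3_open.
have : bounded_set (f @` closure A).
  apply: compact_bounded; apply: continuous_compact => [|].
    exact: continuous_subspaceT.
  apply: bounded_closed_compact; last exact: closed_closure.
  exists r; split; first exact: num_real.
  move=> M rM x Ax; apply: ltW; apply: le_lt_trans rM.
  have : closed_ball 0 r x.
    by apply: (closure_subset Ar); exact: Ax.
  by rewrite closed_ballE// /closed_ball_/= sub0r normrN.
move=> [M [Mr MP]]; exists M; split => // N /MP {}MP t /= At.
by apply: MP; exists (point3 t) => //; exact: subset_closure.
Qed.

(** * Calculus of C^1 fields and of their restrictions to a cell *)

Lemma dotC (R : realType) (u v : pt R) : dot u v = dot v u.
Proof. by apply: eq_bigr => i _; rewrite mulrC. Qed.

Lemma dot_linearl (R : realType) (a : R) (u u' v : pt R) :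
  dot (a *: u + u') v = a * dot u v + dot u' v.
Proof.
rewrite /dot mulr_sumr -big_split; apply: eq_bigr => i _.
by rewrite !mxE mulrDl mulrA.
Qed.

Lemma dot_eq0 (R : realType) (u : pt R) : dot u u = 0 -> u = 0.
Proof.
move=> /eqP; rewrite psumr_eq0 => [|i _]; last by rewrite -expr2 sqr_ge0.
move=> /allP u0; apply/rowP => i; rewrite mxE.
have := u0 i (mem_index_enum i).
by rewrite mulf_eq0 orbb => /eqP.
Qed.

Lemma dot_ge0 (R : realType) (u : pt R) : 0 <= dot u u.
Proof. by apply: sumr_ge0 => i _; rewrite -expr2 sqr_ge0. Qed.

Lemma continuous_sum_ord (R : realType) (V : topologicalType) (n : nat)
    (F : 'I_n -> V -> R) :
  (forall i, continuous (F i)) -> continuous (fun x => \sum_i F i x).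
Proof.
elim: n F => [|n IH] F cF.
  have -> : (fun x => \sum_i F i x) = cst 0.
    by apply/funext => x; rewrite big_ord0.
  exact: cst_continuous.
have -> : (fun x => \sum_i F i x) =
    (fun x => F ord0 x + \sum_(i < n) F (lift ord0 i) x).
  by apply/funext => x; rewrite big_ord_recl.
by move=> x; apply: continuousD; [exact: cF|exact: (IH (fun i => F (lift ord0 i)))].
Qed.

Lemma continuous_dot (R : realType) (f g : pt R -> pt R) :
  (forall i, continuous (fun x => f x 0 i)) ->
  (forall i, continuous (fun x => g x 0 i)) ->
  continuous (fun x => dot (f x) (g x)).
Proof.
move=> cf cg; apply: continuous_sum_ord => i x.
by apply: continuousM; [exact: cf|exact: cg].
Qed.

Lemma C1v_continuous (R : realType) (w : pt R -> pt R) i :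
  C1v w -> continuous (fun x => w x 0 i).
Proof. by move=> /(_ i)[dw _] x; exact: differentiable_continuous. Qed.

Lemma C1v_continuous_div (R : realType) (w : pt R -> pt R) :
  C1v w -> continuous (div w).
Proof. by move=> Cw; apply: continuous_sum_ord => i; have [] := Cw i. Qed.

Lemma partial_linear (R : realType) (i : 'I_3) (a : R) (f g : pt R -> R) :
  C1 f -> C1 g ->
  partial i (fun x => a * f x + g x) =
  (fun x => a * partial i f x + partial i g x).
Proof.
move=> [df _] [dg _]; apply/funext => x.
have Df : derivable f x (delta_mx 0 i) by exact: diff_derivable.
have Dg : derivable g x (delta_mx 0 i) by exact: diff_derivable.
rewrite /partial -[X in 'D__ X x](_ : a *: f + g = _)//.
by rewrite deriveD ?deriveZ//; exact: derivableZ.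
Qed.

Lemma C1_linear (R : realType) (a : R) (f g : pt R -> R) :
  C1 f -> C1 g -> C1 (fun x => a * f x + g x).
Proof.
move=> Cf Cg; split=> [x|i].
  have [[df _] [dg _]] := (Cf, Cg).
  by apply: (@differentiableD _ _ _ (a *: f)) => //; exact: differentiableZ.
have [[_ cf] [_ cg]] := (Cf, Cg); rewrite partial_linear// => x.
apply: (@continuousD _ _ _ (fun y => a * partial i f y) (partial i g)).
  by apply: continuousM; [exact: cst_continuous|exact: cf].
exact: cg.
Qed.

Lemma C1v_linear (R : realType) (a : R) (v w : pt R -> pt R) :
  C1v v -> C1v w -> C1v (fun x => a *: v x + w x).
Proof.
move=> Cv Cw i; have := C1_linear a (Cv i) (Cw i).
by congr C1; apply/funext => x; rewrite !mxE.
Qed.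

Lemma C1v_div_linear (R : realType) (a : R) (v w : pt R -> pt R) :
  C1v v -> C1v w ->
  div (fun x => a *: v x + w x) = (fun x => a * div v x + div w x).
Proof.
move=> Cv Cw; apply/funext => x; rewrite /div mulr_sumr -big_split.
apply: eq_bigr => i _ /=.
rewrite -[RHS]/((fun x => a * partial i (fun y => v y 0 i) x +
  partial i (fun y => w y 0 i) x) x) -partial_linear//.
by congr (partial _ _ _); apply/funext => y; rewrite !mxE.
Qed.

Lemma on_cell_in (R : realType) (Y : nmodType) (P : set (pt R)) (f : pt R -> Y) x :
  P x -> on_cell P f x = f x.
Proof. by move=> Px; rewrite /on_cell /patch mem_set. Qed.

Lemma on_cell_out (R : realType) (Y : nmodType) (P : set (pt R)) (f : pt R -> Y) x :
  ~ P x -> on_cell P f x = 0.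
Proof. by move=> Px; rewrite /on_cell /patch memNset. Qed.

(** Only values near [x] matter, and a neighbourhood of [x] lies in [P], where the extension by zero
    changes nothing. *)
Lemma partial_on_cell (R : realType) (P : set (pt R)) (w : pt R -> pt R) i j x :
  interior P x ->
  partial i (fun y => on_cell P w y 0 j) x = partial i (fun y => w y 0 j) x.
Proof.
move=> Px; apply: near_eq_derive; apply: filterS Px => y Py.
by rewrite on_cell_in.
Qed.

Lemma div_on_cell (R : realType) (P : set (pt R)) (w : pt R -> pt R) x :
  interior P x -> div (on_cell P w) x = div w x.
Proof. by move=> Px; apply: eq_bigr => i _; rewrite partial_on_cell. Qed.

Lemma curl_on_cell (R : realType) (P : set (pt R)) (w : pt R -> pt R) x :
  interior P x -> curl (on_cell P w) x = curl w x.
Proof. by move=> Px; apply/rowP => i; rewrite !mxE !partial_on_cell. Qed.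

(** * Linearity and definiteness of the volume integral *)

Section VolumeIntegral.
Context {R : realType} {A : set (pt R)}.
Hypotheses (A_open : open A) (A_bounded : bounded_set A).

Lemma eq_volume_integral (f g : pt R -> R) : (forall x, A x -> f x = g x) ->
  volume_integral A f = volume_integral A g.
Proof. by move=> fg; apply: eq_Rintegral => t; rewrite inE => /fg. Qed.

Lemma volume_integral_linear (a : R) (f g : pt R -> R) :
  continuous f -> continuous g ->
  volume_integral A (fun x => a * f x + g x) =
  a * volume_integral A f + volume_integral A g.
Proof.
move=> cf cg; have mA := measurable_point3_open A_open.
have If := continuous_point3_integrable A_open A_bounded cf.
have Ig := continuous_point3_integrable A_open A_bounded cg.
have caf : continuous (fun x => a * f x).
  by move=> x; apply: continuousM; [exact: cst_continuous|exact: cf].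
have Iaf := continuous_point3_integrable A_open A_bounded caf.
rewrite /volume_integral.
by rewrite (RintegralD mA Iaf Ig) (RintegralZl a mA If).
Qed.

(** A zero integral makes [f] vanish almost everywhere on [A], but if [f x] were nonzero, [f] would
    be nonzero on a ball in [A], which has positive volume. *)
Lemma volume_integral_eq0 (f : pt R -> R) : continuous f ->
  (forall x, A x -> 0 <= f x) -> volume_integral A f = 0 ->
  forall x, A x -> f x = 0.
Proof.
move=> cf f0 If0 x Ax; apply/eqP/negPn/negP => fx0.
have mA := measurable_point3_open A_open.
have If := continuous_point3_integrable A_open A_bounded cf.
have fA0 : (\int[volume3 R]_(t in @point3 R @^-1` A) `|(f (point3 t))%:E| = 0)%E.
  transitivity (\int[volume3 R]_(t in @point3 R @^-1` A) (f (point3 t))%:E)%E.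
    by apply: eq_integral => t; rewrite inE => At; rewrite gee0_abs// lee_fin f0.
  rewrite -[LHS]fineK; first by congr (_%:E).
  exact: (integrable_fin_num mA If).
have mf := measurable_int _ If.
have [N [mN N0 fN]] := (ae_eq_integral_abs _ mA mf).1 fA0.
have nx : nbhs x [set y | A y /\ f y != 0].
  apply: filterI; first exact: open_nbhs_nbhs.
  exact: cvgr_neq0 (cf x) fx0.
have /nbhs_ballP[e /= e0 eN] := nx.
have : (volume3 R (@point3 R @^-1` ball x e) <= volume3 R N)%E.
  apply: le_measure; rewrite ?inE//; first exact: measurable_point3_ball.
  move=> t /eN[At ft]; apply: fN => /= /(_ At)[] /eqP.
  by apply/negP.
by rewrite N0 volume3_ball// lee_fin leNgt exprn_gt0// mulrn_wgt0.
Qed.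

End VolumeIntegral.

Lemma volume_integral_ge0 (R : realType) (A : set (pt R)) (f : pt R -> R) :
  (forall x, A x -> 0 <= f x) -> 0 <= volume_integral A f.
Proof. by move=> f0; apply: Rintegral_ge0 => t /f0. Qed.

(** * The curl of a field with zero tangential trace *)

Definition convex_subset (R : realType) (P : set (pt R)) : Prop :=
  forall x y t, P x -> P y -> 0 <= t <= 1 -> P (x + t *: (y - x)).

Lemma hull_convex (R : realType) (V : seq (pt R)) : convex_subset (hull V).
Proof.
move=> x y t [c [c0 c1 ->]] [d [d0 d1 ->]] /andP[t0 t1].
exists (fun i => (1 - t) * c i + t * d i); split.
- by move=> i; rewrite addr_ge0// mulr_ge0// subr_ge0.
- by rewrite big_split -!mulr_sumr c1 d1 /=; ring.
- rewrite -sumrB scaler_sumr -big_split; apply: eq_bigr => i _ /=.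
  by apply/rowP => j; rewrite !mxE; ring.
Qed.

Lemma hull_bounded (R : realType) (V : seq (pt R)) : bounded_set (hull V).
Proof.
exists (\sum_(i < size V) `|V`_i|); split; first exact: num_real.
move=> M VM x [c [c0 c1 ->]]; apply: ltW; apply: le_lt_trans VM.
apply: le_trans (ler_norm_sum _ _ _) _; apply: ler_sum => i _.
rewrite normrZ ger0_norm// ler_piMl// -c1 (bigD1 i)//= lerDl.
exact: sumr_ge0.
Qed.

(** If [f x] were nonzero, [f] would be nonzero on a ball about [x], which contains [x + t *: v] for
    small positive [t]. *)
Lemma continuous_ray_eq0 (R : realType) (f : pt R -> R) (x v : pt R) :
  continuous f -> (forall t, 0 < t <= 1 -> f (x + t *: v) = 0) -> f x = 0.
Proof.
move=> cf f0; apply/eqP/negPn/negP => fx0.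
have /nbhs_ballP[e /= e0 eN] : \forall y \near x, f y != 0.
  exact: cvgr_neq0 (cf x) fx0.
have v0 : 0 < `|v| + 1 by rewrite ltr_wpDl.
(* The summand 1 covers [v = 0] and makes the distance from [x] strictly smaller than [e]. *)
pose t := Num.min 1 (e / (`|v| + 1)).
have t0 : 0 < t by rewrite lt_min ltr01 divr_gt0.
have /eqP : f (x + t *: v) = 0 by apply: f0; rewrite t0 ge_min lexx.
apply/negP.
apply: eN; rewrite -ball_normE /ball_ /= opprD addNKr normrN normrZ gtr0_norm//.
apply: (@lt_le_trans _ _ (t * (`|v| + 1))); first by rewrite ltr_pM2l// ltrDl.
by rewrite -ler_pdivlMr// ge_min lexx orbT.
Qed.

(** The segment from [x] to an interior point [z] enters the interior at once: the homothety with
    centre [x] and ratio [t] maps a ball about [z] in [P] to a ball that is in [P] by convexity. *)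
Lemma convex_interior_dense (R : realType) (P : set (pt R)) (f : pt R -> R) :
  convex_subset P -> interior P !=set0 -> continuous f ->
  (forall x, interior P x -> f x = 0) -> forall x, P x -> f x = 0.
Proof.
move=> cP [z Pz] cf f0 x Px; apply: (@continuous_ray_eq0 _ f x (z - x)) => //.
move=> t /andP[t0 t1]; apply: f0.
have /nbhs_ballP[r /= r0 rP] := Pz.
rewrite /interior -nbhs_ballE; exists (t * r); first exact: mulr_gt0.
move=> y; rewrite -ball_normE /ball_ /= => yr.
have -> : y = x + t *: ((z + t^-1 *: (y - (x + t *: (z - x)))) - x).
  by apply/rowP => j; rewrite !mxE; field; rewrite gt_eqF.
apply: cP; rewrite ?(ltW t0)//; apply: rP.
rewrite -ball_normE /ball_ /= opprD addNKr normrN normrZ gtr0_norm ?invr_gt0//.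
by rewrite ltr_pdivrMl// distrC.
Qed.

(** A one-sided segment suffices: differentiability provides the two-sided limit of the difference
    quotients, and these vanish for small positive [t]. *)
Lemma derive_segment_eq0 (R : realType) (h : pt R -> R) (x s : pt R) (e : R) :
  differentiable h x -> 0 < e -> (forall t, 0 <= t <= e -> h (x + t *: s) = 0) ->
  'D_s h x = 0.
Proof.
move=> dh e0 h0; apply/eqP/negPn/negP => D0.
have cD : (fun t => t^-1 *: ((h \o shift x) (t *: s) - h x)) @ 0^'
   --> 'D_s h x by exact: diff_derivable.
have /nbhs_ballP[d /= d0 dN] :
    \forall r \near 0^', r^-1 *: ((h \o shift x) (r *: s) - h x) != 0.
  exact: cvgr_neq0 cD D0.
pose t := Num.min e (d / 2).
have t0 : 0 < t by rewrite lt_min e0 divr_gt0.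
have td : t < d by rewrite gt_min; apply/orP; right; lra.
have := dN t; rewrite -ball_normE /ball_ /= sub0r normrN gtr0_norm// => /(_ td).
rewrite gt_eqF// => /(_ isT) /eqP; apply.
have hx : h x = 0 by rewrite -[x]addr0 -(scale0r s) h0// lexx ltW.
have ht : h (t *: s + x) = 0 by rewrite addrC h0// ltW//= ge_min lexx.
by rewrite /= ht hx subrr scaler0.
Qed.

Lemma derive_partial (R : realType) (h : pt R -> R) (x s : pt R) :
  differentiable h x -> 'D_s h x = \sum_i s 0 i * partial i h x.
Proof.
move=> dh; rewrite deriveE// [in LHS](row_sum_delta s) linear_sum.
by apply: eq_bigr => i _; rewrite linearZ /partial deriveE.
Qed.

Lemma dot_crossr (R : realType) (u v w : pt R) :
  cross u (cross v w) = dot u w *: v - dot u v *: w.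
Proof.
apply/rowP; apply: ord3P; rewrite !mxE /dot !sum_ord3 !ord3_cycle; ring.
Qed.

(** For a unit vector [n], the triple product expansion reads
    [cross n (cross n u) = dot n u *: n - u]. *)
Lemma unit_cross_eq0 (R : realType) (n u : pt R) :
  dot n n = 1 -> cross n u = 0 -> u = dot n u *: n.
Proof.
move=> n1 nu0; have := dot_crossr n n u.
rewrite nu0 n1 scale1r => /eqP; rewrite eq_sym.
have -> : cross n (0 : pt R) = 0.
  by apply/rowP => i; rewrite !mxE !mulr0 subrr.
by rewrite subr_eq0 => /eqP.
Qed.

Lemma dot_linearr (R : realType) (a : R) (u v v' : pt R) :
  dot u (a *: v + v') = a * dot u v + dot u v'.
Proof. by rewrite ![dot u _]dotC dot_linearl. Qed.

Lemma dotBr (R : realType) (u v v' : pt R) : dot u (v - v') = dot u v - dot u v'.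
Proof. by rewrite addrC -scaleN1r dot_linearr mulN1r addrC. Qed.

Lemma dotZr (R : realType) (a : R) (u v : pt R) : dot u (a *: v) = a * dot u v.
Proof.
rewrite -[a *: v]addr0 dot_linearr [X in _ + X]big1 ?addr0// => i _.
by rewrite mxE mulr0.
Qed.

(** By [derive_dot], the double sums are the derivatives of [dot (w y) t] along [s] and of
    [dot (w y) s] along [t]. *)
Lemma dot_cross_curl (R : realType) (w : pt R -> pt R) (s t x : pt R) :
  dot (cross s t) (curl w x) =
  \sum_i s 0 i * (\sum_j t 0 j * partial i (fun y => w y 0 j) x) -
  \sum_i t 0 i * (\sum_j s 0 j * partial i (fun y => w y 0 j) x).
Proof. rewrite /dot !sum_ord3 !mxE !ord3_cycle; ring. Qed.

Lemma C1v_continuous_curl (R : realType) (w : pt R -> pt R) i :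
  C1v w -> continuous (fun x => curl w x 0 i).
Proof.
move=> Cw.
have -> : (fun x => curl w x 0 i) = (fun x =>
    partial (i + 1) (fun y => w y 0 (i + 2)) x -
    partial (i + 2) (fun y => w y 0 (i + 1)) x).
  by apply/funext => x; rewrite mxE.
move=> x; apply: continuousB; first by have [_] := Cw (i + 2); apply.
by have [_] := Cw (i + 1); apply.
Qed.

Lemma derive_dot (R : realType) (w : pt R -> pt R) (s t x : pt R) : C1v w ->
  differentiable (fun y => dot (w y) t) x /\
  'D_s (fun y => dot (w y) t) x =
  \sum_i s 0 i * (\sum_j t 0 j * partial i (fun y => w y 0 j) x).
Proof.
move=> Cw.
have dj j : differentiable (t 0 j *: (fun y => w y 0 j)) x.
  by apply: differentiableZ; have [] := Cw j.
have -> : (fun y => dot (w y) t) = \sum_(j < 3) (t 0 j *: (fun y => w y 0 j)).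
  by apply/funext => y; rewrite fct_sumE; apply: eq_bigr => j _; rewrite mulrC.
split; first exact: differentiable_sum.
rewrite derive_partial; last exact: differentiable_sum.
apply: eq_bigr => i _; congr (_ * _); rewrite /partial derive_sum => [|j]; last first.
  exact: diff_derivable.
apply: eq_bigr => j _; rewrite deriveZ//.
by apply: diff_derivable; have [] := Cw j.
Qed.

(* With s, t edge vectors spanning the facet, n is a multiple of s x t and
   (s x t) . curl w = D_s (w . t) - D_t (w . s), where w . s and w . t vanish on
   F.  This is used at points moved from x towards the vertex a, where F contains
   short segments in the directions s and t. *)
Lemma facet_curl_eq0 (R : realType) (P F : set (pt R)) (n : pt R)
    (w : pt R -> pt R) :
  convex_subset P -> facet P n F -> C1v w ->
  (forall x, F x -> cross n (w x) = 0) ->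
  forall x, F x -> dot n (curl w x) = 0.
Proof.
move=> cP [n1 [k [nk FE]] [a [b [c [Fa Fb Fc abc0]]]]] Cw w0 x Fx.
have cF : convex_subset F.
  move=> y z t; rewrite FE => -[Py /= yk] [Pz /= zk] t01; split; first exact: cP.
  by rewrite /= addrC dot_linearr dotBr yk zk subrr mulr0 add0r.
have nF y z : F y -> F z -> dot n (y - z) = 0.
  by rewrite FE dotBr => -[_ /= ->] [_ /= ->]; rewrite subrr.
set s := b - a in abc0; set t := c - a in abc0.
have ns : dot n s = 0 by exact: nF.
have nt : dot n t = 0 by exact: nF.
(* The triple product expansion of [cross n (cross s t)] has coefficients [dot n t] and [dot n s],
   both zero. *)
have st : cross s t = dot n (cross s t) *: n.
  by apply: unit_cross_eq0; rewrite // dot_crossr ns nt !scale0r subrr.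
have lam0 : dot n (cross s t) != 0.
  by apply: contraNneq abc0 => l0; rewrite st l0 scale0r.
suff : dot (cross s t) (curl w x) = 0.
  rewrite dotC st dotZr [dot (curl _ _) _]dotC => /eqP; rewrite mulf_eq0 (negbTE lam0).
  by move/eqP.
(* On [F] the field [w] is parallel to [n], hence orthogonal to tangent directions. *)
have tangent0 u y : dot n u = 0 -> F y -> dot (w y) u = 0.
  move=> nu Fy; rewrite (unit_cross_eq0 n1 (w0 _ Fy)).
  by rewrite dotC dotZr [dot u n]dotC nu mulr0.
(* For [r <= e] this point is a convex combination of [y], [a] and [z]; the shift towards [a] makes
   room for the move along [z - a]. *)
have corner y z e : F y -> F z -> 0 < e <= 1 -> forall r, 0 <= r <= e ->
    F (y + e *: (a - y) + r *: (z - a)).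
  move=> Fy Fz /andP[e0 e1] r /andP[r0 re].
  have -> : y + e *: (a - y) + r *: (z - a) =
            y + e *: (a + (r / e) *: (z - a) - y).
    by apply/rowP => j; rewrite !mxE; field; rewrite gt_eqF.
  apply: (cF) => //; last by rewrite ltW.
  apply: (cF) => //; apply/andP; split; first by rewrite divr_ge0// ltW.
  by rewrite ler_pdivrMr// mul1r.
apply: (@continuous_ray_eq0 _ (fun y => dot (cross s t) (curl w y)) x (a - x)).
  apply: continuous_dot => i; first exact: cst_continuous.
  exact: C1v_continuous_curl.
move=> e e01; rewrite dot_cross_curl; have e0 : 0 < e by case/andP: e01.
set y := x + _.
have [dt <-] := derive_dot s t y Cw; have [ds <-] := derive_dot t s y Cw.
rewrite (derive_segment_eq0 dt e0) => [|r re]; last first.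
  by apply: tangent0 => //; exact: corner.
rewrite (derive_segment_eq0 ds e0) => [|r re]; last first.
  by apply: tangent0 => //; exact: corner.
by rewrite subrr.
Qed.

(** * The H(div) Gram matrix *)

Lemma subspace_lincomb (R : realType) (E : lmodType R) (V : set E)
    (m : nat) (b : 'I_m -> E) (c : 'cV[R]_m) :
  Defs.subspace V -> (forall j, V (b j)) -> V (lincomb b c).
Proof.
move=> [V0 Vlin] Vb; rewrite /lincomb.
by elim/big_rec: _ => [|j f _ Vf]; [exact: V0|exact: Vlin].
Qed.

(** As [L] is linear on [V] only, the induction carries membership of the partial sums in [V]. It
    serves [hdiv] and the degrees of freedom, with [pwC1] as [V]. *)
Lemma linear_lincomb (R : realType) (E : lmodType R) (V : set E) (L : E -> R)
    (m : nat) (b : 'I_m -> E) (c : 'cV[R]_m) :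
  Defs.subspace V -> (forall a f g, V f -> V g -> L (a *: f + g) = a * L f + L g) ->
  (forall j, V (b j)) ->
  L (lincomb b c) = \sum_j c j 0 * L (b j).
Proof.
move=> [V0 Vlin] Llin Vb.
have L0 : L 0 = 0.
  by have := Llin (- 1) 0 0 V0 V0; rewrite scaler0 addr0 mulN1r addNr.
suff : V (lincomb b c) /\ L (lincomb b c) = \sum_j c j 0 * L (b j) by case.
rewrite /lincomb; elim/big_rec2: _ => // j x f _ [Vf Lf].
by split; [exact: Vlin|rewrite Llin// Lf].
Qed.

Lemma lincombB (R : realType) (E : lmodType R) (m : nat) (b : 'I_m -> E)
    (c d : 'cV[R]_m) :
  lincomb b (c - d) = lincomb b c - lincomb b d.
Proof.
by rewrite /lincomb -sumrB; apply: eq_bigr => j _; rewrite !mxE scalerBl.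
Qed.

Lemma lincomb_inj (R : realType) (E : lmodType R) (V : set E) (m : nat)
    (b : 'I_m -> E) (c d : 'cV[R]_m) :
  is_basis V b -> lincomb b c = lincomb b d -> c = d.
Proof.
move=> [_ _ free] cd; apply/eqP; rewrite -subr_eq0; apply/eqP/free.
by rewrite lincombB cd subrr.
Qed.

Lemma coef_lincomb (R : realType) (E : lmodType R) (V : set E) (m : nat)
    (b : 'I_m -> E) (c : 'cV[R]_m) :
  is_basis V b -> coef b (lincomb b c) = c.
Proof.
move=> hb; rewrite /coef; case: xgetP => [d _ /esym|/(_ c) []//].
exact: lincomb_inj hb.
Qed.

Lemma C1_0 (R : realType) : C1 (fun=> 0 : R).
Proof.
split=> [x|i]; first exact: differentiable_cst.
have -> : partial i (fun=> 0 : R) = cst 0.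
  by apply/funext => x; exact: derive_cst.
exact: cst_continuous.
Qed.

Lemma pwC1_subspace (R : realType) (T : finType) (cell : T -> set (pt R)) :
  Defs.subspace (pwC1 cell).
Proof.
split=> [e|a v w Cv Cw e].
  exists (fun=> 0); first by move=> i; under eq_fun do rewrite mxE; exact: C1_0.
  by apply/funext => x; rewrite /on_cell /patch; case: ifP.
have [[f Cf vf] [g Cg wg]] := (Cv e, Cw e).
exists (fun x => a *: f x + g x); first exact: C1v_linear.
apply/funext => x; have -> : (a *: v + w) e x = a *: v e x + w e x by [].
rewrite vf wg; have [Px|Px] := pselect (cell e x); first by rewrite !on_cell_in.
by rewrite !on_cell_out// scaler0 addr0.
Qed.

Section Hdiv.
Context {R : realType} {Omega : set (pt R)} {T : finType} {cell : T -> set (pt R)}.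
Hypothesis hmesh : mesh Omega cell.

Lemma cell_convex e : convex_subset (cell e).
Proof. by have [V ->] := cell_polytope hmesh e; exact: hull_convex. Qed.

Lemma cell_interior_bounded e : bounded_set (interior (cell e)).
Proof.
have [V eV] := cell_polytope hmesh e; have [M [Mreal VM]] := hull_bounded V.
by exists M; split=> // N /VM VN x /interior_subset; rewrite eV; exact: VN.
Qed.

Lemma cell_continuous_eq0 e (f : pt R -> R) : continuous f ->
  (forall x, interior (cell e) x -> f x = 0) -> forall x, cell e x -> f x = 0.
Proof.
exact: (convex_interior_dense (@cell_convex e) (cell_solid hmesh e)).
Qed.

Lemma hdivC (s t : vector_fun R T) : hdiv cell s t = hdiv cell t s.
Proof.
by congr (_ + _); apply: eq_bigr => e _; apply: eq_volume_integral => x _;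
  [exact: dotC|exact: mulrC].
Qed.

(** Integrability is available for functions continuous on the whole space; [f] and [g] represent
    [u] and [v] by such functions inside the cell. *)
Lemma cell_integral_linear e (a : R) (u v w f g : pt R -> R) :
  continuous f -> continuous g ->
  (forall x, interior (cell e) x -> u x = f x) ->
  (forall x, interior (cell e) x -> v x = g x) ->
  (forall x, interior (cell e) x -> w x = a * f x + g x) ->
  volume_integral (interior (cell e)) w =
  a * volume_integral (interior (cell e)) u +
  volume_integral (interior (cell e)) v.
Proof.
move=> cf cg uf vg wfg.
rewrite (eq_volume_integral wfg) (eq_volume_integral uf) (eq_volume_integral vg).
rewrite volume_integral_linear//; first exact: open_interior.
exact: cell_interior_bounded.
Qed.

Lemma hdiv_linearl (t : vector_fun R T) : pwC1 cell t ->
  forall a s s', pwC1 cell s -> pwC1 cell s' ->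
  hdiv cell (a *: s + s') t = a * hdiv cell s t + hdiv cell s' t.
Proof.
move=> Ct a s s' Cs Cs'; rewrite /hdiv mulrDr addrACA.
have Eadd e : (a *: s + s') e = (fun x => a *: s e x + s' e x) by [].
congr (_ + _); rewrite mulr_sumr -big_split; apply: eq_bigr => e _ /=;
  rewrite Eadd.
  have [[f Cf ->] [g Cg ->] [h Ch ->]] := And3 (Cs e) (Cs' e) (Ct e).
  apply: (@cell_integral_linear e a _ _ _ (fun x => dot (f x) (h x))
    (fun x => dot (g x) (h x))) => [||x Px|x Px|x Px].
  - by apply: continuous_dot => i; exact: C1v_continuous.
  - by apply: continuous_dot => i; exact: C1v_continuous.
  - by rewrite !on_cell_in//; exact: interior_subset.
  - by rewrite !on_cell_in//; exact: interior_subset.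
  - by rewrite !on_cell_in ?dot_linearl//; exact: interior_subset.
have [[f Cf ->] [g Cg ->] [h Ch ->]] := And3 (Cs e) (Cs' e) (Ct e).
have cdiv u v : C1v u -> C1v v -> continuous (fun x => div u x * div v x).
  by move=> Cu Cv x; apply: continuousM; exact: C1v_continuous_div.
apply: (@cell_integral_linear e a _ _ _ (fun x => div f x * div h x)
  (fun x => div g x * div h x)) => [||x Px|x Px|x Px].
- exact: cdiv.
- exact: cdiv.
- by rewrite !div_on_cell.
- by rewrite !div_on_cell.
(* Writing the combination as one extension by zero lets [div_on_cell] reduce it to C^1 fields. *)
have -> : (fun x => a *: on_cell (cell e) f x + on_cell (cell e) g x) =
    on_cell (cell e) (fun x => a *: f x + g x).
  apply/funext => y; have [Py|Py] := pselect (cell e y).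
    by rewrite !on_cell_in.
  by rewrite !on_cell_out// scaler0 addr0.
by rewrite !div_on_cell// C1v_div_linear// mulrDl mulrA.
Qed.

Lemma hdiv_ge0 (s : vector_fun R T) : 0 <= hdiv cell s s.
Proof.
by rewrite addr_ge0// sumr_ge0// => e _; apply: volume_integral_ge0 => x _;
  [exact: dot_ge0|rewrite -expr2 sqr_ge0].
Qed.

(** The L^2 part is definite: in each cell the squared length of a continuous representative
    vanishes in the interior, hence on the closed cell by density; outside the cell [s e] is zero by
    convention. *)
Lemma hdiv_eq0 (s : vector_fun R T) : pwC1 cell s -> hdiv cell s s = 0 -> s = 0.
Proof.
move=> Cs /eqP; rewrite paddr_eq0; last 2 first.
- by apply: sumr_ge0 => e _; apply: volume_integral_ge0 => x _; exact: dot_ge0.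
- apply: sumr_ge0 => e _; apply: volume_integral_ge0 => x _.
  by rewrite -expr2 sqr_ge0.
move=> /andP[/eqP s0 _]; apply/funext => e; apply/funext => x.
have [f Cf ef] := Cs e.
have cff : continuous (fun x => dot (f x) (f x)).
  by apply: continuous_dot => i; exact: C1v_continuous.
rewrite ef; have [Px|Px] := pselect (cell e x); last by rewrite on_cell_out.
rewrite on_cell_in//; apply: dot_eq0.
apply: (@cell_continuous_eq0 e (fun x => dot (f x) (f x))) => //.
apply: volume_integral_eq0 => //.
- exact: open_interior.
- exact: cell_interior_bounded.
- by move=> y _; exact: dot_ge0.
transitivity (volume_integral (interior (cell e)) (fun x => dot (s e x) (s e x))).
  apply: eq_volume_integral => y Py.
  by rewrite ef on_cell_in//; exact: interior_subset.
have /eqP := s0; rewrite psumr_eq0 => [|e' _]; last first.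
  by apply: volume_integral_ge0 => y _; exact: dot_ge0.
by move=> /allP/(_ e (mem_index_enum e)) /eqP.
Qed.

End Hdiv.

Section GramMatrix.
Context {R : realType} {Omega : set (pt R)} {T : finType} {cell : T -> set (pt R)}.
Hypothesis hmesh : mesh Omega cell.
Context {m : nat} {phi : 'I_m -> vector_fun R T}.
Hypothesis phi_C1 : forall j, pwC1 cell (phi j).

Lemma gram_sym : (gram cell phi)^T = gram cell phi.
Proof. by apply/matrixP => i j; rewrite !mxE hdivC. Qed.

Lemma ip_gram (c : 'cV[R]_m) :
  ip (gram cell phi *m c) c = hdiv cell (lincomb phi c) (lincomb phi c).
Proof.
have sub := pwC1_subspace cell.
have lin t (Ct : pwC1 cell t) :=
  linear_lincomb c sub (hdiv_linearl hmesh Ct) phi_C1.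
rewrite lin; last exact: (subspace_lincomb c sub phi_C1).
apply: eq_bigr => i _; rewrite mulrC hdivC lin// mxE; congr (_ * _).
by apply: eq_bigr => j _; rewrite mxE mulrC.
Qed.

Lemma ip_gram_eq0 (V : set (vector_fun R T)) (c : 'cV[R]_m) :
  is_basis V phi -> ip (gram cell phi *m c) c = 0 -> c = 0.
Proof.
move=> [_ _ free]; rewrite ip_gram => c0; apply: free.
apply: (hdiv_eq0 hmesh) c0.
exact: (subspace_lincomb c (pwC1_subspace cell) phi_C1).
Qed.

End GramMatrix.

(** A kernel vector of the interior block, padded with zeros, has zero energy and so vanishes. *)
Lemma posdef_ulsubmx_unit (R : realType) (mi mf : nat) (D : 'M[R]_(mi + mf)) :
  D^T = D -> (forall c, ip (D *m c) c = 0 -> c = 0) -> ulsubmx D \in unitmx.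
Proof.
move=> symD posD; rewrite unitmxE unitfE; apply/negP => /det0P[v v0 vD].
move/negP: v0; apply; have : col_mx v^T 0 = 0 :> 'cV_(mi + mf).
  apply: posD; rewrite -{1}(submxK D) mul_block_col !mulmx0 !addr0 ip_col_mx.
  rewrite [X in _ + X]big1 => [|i _]; last by rewrite [(0 : 'cV_mf) i 0]mxE mulr0.
  rewrite ipE trmx_mul trmxK.
  have -> : (ulsubmx D)^T = ulsubmx D by rewrite -[in RHS]symD trmx_ulsub.
  by rewrite vD mul0mx mxE addr0.
move=> /(congr1 usubmx); rewrite col_mxKu linear0 => /(congr1 trmx).
by rewrite trmxK trmx0 => ->.
Qed.

(** * Block triangularity of the interpolation and curl matrices *)

Section BlockTriangular.
Context {R : realType} {Omega : set (pt R)} {T : finType} {cell : T -> set (pt R)}.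
Hypothesis hmesh : mesh Omega cell.
Context {p k : nat} {VR VN : T -> set (pt R -> pt R)} {VU : T -> set (pt R -> R)}.
Hypothesis hV : local_spaces cell p k VR VN VU.
Context {ri rf : nat} {phi : 'I_(ri + rf) -> vector_fun R T}.
Hypothesis hphi : is_basis (Rh cell VR) phi.
Context {dof : 'I_(ri + rf) -> vector_fun R T -> R}.
Hypothesis hdof : RT_dofs cell phi dof.

Lemma Rh_pwC1 r : Rh cell VR r -> pwC1 cell r.
Proof. by move=> [Vr _] e; apply: (VR_C1 hV); exact: Vr. Qed.

Lemma Nh_pwC1 w : Nh cell VN w -> pwC1 cell w.
Proof. by move=> [Vw _] e; apply: (VN_C1 hV); exact: Vw. Qed.

Lemma Uh3_pwC1 z : Uh3 Omega cell VU z -> pwC1 cell z.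
Proof.
move=> Uz e.
have zC1 d : exists2 g, C1 g & (fun x => z e x 0 d) = on_cell (cell e) g.
  by have [Vz _ _] := Uz d; apply: (VU_C1 hV); exact: Vz.
(* Each component has its own C^1 representative; the chosen ones are assembled into a vector
   field. *)
pose g d := projT1 (cid2 (zC1 d)).
exists (fun x => \row_d g d x) => [d|].
  have -> : (fun x => (\row_d g d x) 0 d) = g d.
    by apply/funext => x; rewrite mxE.
  by rewrite /g; case: cid2.
apply/funext => x; apply/rowP => d.
have -> : z e x 0 d = on_cell (cell e) (g d) x.
  by rewrite /g; case: cid2 => h _ /= <-.
have [Px|Px] := pselect (cell e x); first by rewrite !on_cell_in// mxE.
by rewrite !on_cell_out// mxE.
Qed.

Lemma Rh_subspace : Defs.subspace (Rh cell VR).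
Proof.
split=> [|a r r' [Vr rc] [Vr' rc']]; split=> [e|e e' n F Fe Fe' x Fx] //.
- by have [] := VR_sub hV e.
- by have [_] := VR_sub hV e; apply.
have E e0 : (a *: r + r') e0 x = a *: r e0 x + r' e0 x by [].
by rewrite !E !dot_linearr (rc _ _ _ _ Fe Fe' _ Fx) (rc' _ _ _ _ Fe Fe' _ Fx).
Qed.

Lemma basis_pwC1 j : pwC1 cell (phi j).
Proof. by apply: Rh_pwC1; have [] := hphi. Qed.

(** By duality [dof j] reads off a coefficient, so entries of [Pi] and [C] become degrees of freedom
    of the functions that their columns represent. *)
Lemma dof_lincomb j c : dof j (lincomb phi c) = c j 0.
Proof.
rewrite (linear_lincomb c (pwC1_subspace cell) (dof_linear hdof j) basis_pwC1).
rewrite (bigD1 j)//= big1 ?addr0 => [|l /negbTE lj].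
  by rewrite (dof_dual hdof) eqxx mulr1.
by rewrite (dof_dual hdof) eq_sym lj mulr0.
Qed.

(** The degree of freedom only sees the normal component on one facet, where [v] agrees with the
    zero field. *)
Lemma dof_interface_eq0 (j : 'I_rf) v : pwC1 cell v ->
  zero_normal_trace cell v -> dof (rshift ri j) v = 0.
Proof.
move=> Cv v0; have [e [n [F [nF dofF]]]] := dof_interface hdof j.
have [C0 _] := pwC1_subspace cell.
have dof0 : dof (rshift ri j) 0 = 0.
  have := dof_linear hdof (rshift ri j) (- 1) C0 C0.
  by rewrite scaler0 addr0 mulN1r addNr.
rewrite -dof0; apply: dofF => // x Fx; rewrite (v0 _ _ _ nF _ Fx).
by rewrite /dot big1// => i _; rewrite mxE mulr0.
Qed.

(** An entry of this block is an interface degree of freedom of an interior function, which vanishes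
    on every facet. *)
Lemma interpolation_matrix_dlsubmx (ui uf : nat)
    (zeta : 'I_(ui + uf) -> vector_fun R T) (Pi : 'M[R]_(ri + rf, ui + uf)) :
  (forall l, Uh3 Omega cell VU (zeta l)) ->
  interior_interface (zero_trace cell) zeta ->
  is_RT_interpolation_matrix phi dof zeta Pi -> dlsubmx Pi = 0.
Proof.
move=> Uzeta [bubble _] hPi; apply/matrixP => j l; rewrite !mxE.
have -> : Pi (rshift ri j) (lshift uf l) =
    col (lshift uf l) Pi (rshift ri j) 0 by rewrite mxE.
rewrite -dof_lincomb -hPi.
have -> : RT_interpolation phi dof (zeta (lshift uf l)) =
    lincomb phi (\col_i dof i (zeta (lshift uf l))).
  by apply: eq_bigr => i _; rewrite mxE.
rewrite dof_lincomb mxE; apply: dof_interface_eq0; first exact: Uh3_pwC1.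
move=> e n F nF x Fx; rewrite (bubble l _ _ _ nF _ Fx).
by rewrite /dot big1// => i _; rewrite mxE mulr0.
Qed.

(** An entry of this block is an interface degree of freedom of the curl of an interior function,
    whose normal component on facets vanishes by [facet_curl_eq0]. *)
Lemma curl_matrix_dlsubmx (ni nf : nat) (psi : 'I_(ni + nf) -> vector_fun R T)
    (C : 'M[R]_(ri + rf, ni + nf)) :
  (forall l, Nh cell VN (psi l)) ->
  interior_interface (zero_tangential_trace cell) psi ->
  is_curl_matrix cell phi psi C -> dlsubmx C = 0.
Proof.
move=> Npsi [bubble _] hC; apply/matrixP => j l; rewrite !mxE.
have -> : C (rshift ri j) (lshift nf l) =
    col (lshift nf l) C (rshift ri j) 0 by rewrite mxE.
set c := col _ _; rewrite -dof_lincomb.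
have Cr : pwC1 cell (lincomb phi c).
  exact: (subspace_lincomb c (pwC1_subspace cell) basis_pwC1).
apply: dof_interface_eq0 => // e n F nF x Fx.
have Px : cell e x by have [_ [k' [_ FE]] _] := nF; move: Fx; rewrite FE => -[].
have [g Cg eg] := Cr e; have [w Cw ew] := Nh_pwC1 (Npsi (lshift nf l)) e.
have curlE y : interior (cell e) y -> curl w y = g y.
  move=> Py; rewrite -(@curl_on_cell _ (cell e))// -ew (hC _ _ _ Py) eg.
  by rewrite on_cell_in//; exact: interior_subset.
have wF y : F y -> cross n (w y) = 0.
  move=> Fy; have := bubble l e n F nF y Fy; rewrite ew on_cell_in//.
  by have [_ [k' [_ FE]] _] := nF; move: Fy; rewrite FE => -[].
rewrite eg on_cell_in//.
have curl0 := facet_curl_eq0 (cell_convex hmesh (e := e)) nF Cw wF Fx.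
(* [g] and [curl w] are known to agree only in the interior of the cell; continuity extends the
   agreement to the facet point [x]. *)
suff : dot n (g x) - dot n (curl w x) = 0 by rewrite curl0 subr0.
have cdot (h : pt R -> pt R) : (forall i, continuous (fun y => h y 0 i)) ->
    continuous (fun y => dot n (h y)).
  by move=> ch; apply: continuous_dot => // i; exact: cst_continuous.
apply: (cell_continuous_eq0 hmesh (e := e)
  (f := fun y => dot n (g y) - dot n (curl w y))) => // [|y Py].
  have cg : continuous (fun y => dot n (g y)).
    by apply: cdot => i; exact: C1v_continuous.
  have cw : continuous (fun y => dot n (curl w y)).
    by apply: cdot => i; exact: C1v_continuous_curl.
  by move=> y; exact: continuousB (cg y) (cw y).
by rewrite curlE// subrr.
Qed.

End BlockTriangular.

(** * Decomposition of the interface coefficients *)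

Unset Implicit Arguments.

Theorem lemma5p1 (R : realType) (Omega : set 'rV[R]_3)
    (hOmega : polyhedral_domain Omega)
    (T : finType) (cell : T -> set 'rV[R]_3) (hmesh : mesh Omega cell)
    (p k : nat) (hp : (1 <= p)%N) (hk : (1 <= k)%N)
    (VR VN : T -> set ('rV[R]_3 -> 'rV[R]_3)) (VU : T -> set ('rV[R]_3 -> R))
    (hV : local_spaces cell p k VR VN VU)
    (ri rf ui uf ni nf : nat)
    (phi : 'I_(ri + rf) -> vector_fun R T)
    (hphi : is_basis (Rh cell VR) phi)
    (hphi_split : interior_interface (zero_normal_trace cell) phi)
    (dof : 'I_(ri + rf) -> vector_fun R T -> R) (hdof : RT_dofs cell phi dof)
    (zeta : 'I_(ui + uf) -> vector_fun R T)
    (hzeta : is_basis (Uh3 Omega cell VU) zeta)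
    (hzeta_split : interior_interface (zero_trace cell) zeta)
    (psi : 'I_(ni + nf) -> vector_fun R T)
    (hpsi : is_basis (Nh cell VN) psi)
    (hpsi_split : interior_interface (zero_tangential_trace cell) psi)
    (Pi : 'M[R]_(ri + rf, ui + uf))
    (hPi : is_RT_interpolation_matrix phi dof zeta Pi)
    (C : 'M[R]_(ri + rf, ni + nf)) (hC : is_curl_matrix cell phi psi C)
    (c5 : R) (hc5 : 0 < c5) :
  let D := gram cell phi in
  let S := schur D in
  (forall u, Rh cell VR u -> exists v z y : vector_fun R T,
     [/\ [/\ Rh cell VR v, Uh3 Omega cell VU z & Nh cell VN y],
         coef phi u = coef phi v + Pi *m coef zeta z + C *m coef psi y
       & ip (diag_of D *m coef phi v) (coef phi v)
         + ip (D *m (Pi *m coef zeta z)) (Pi *m coef zeta z)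
         + ip (D *m (C *m coef psi y)) (C *m coef psi y)
         <= c5 * ip (D *m coef phi u) (coef phi u)]) ->
  forall q, Qh cell VR q ->
    let qc := coef (fun j => ntrace cell (phi (rshift ri j))) q in
    exists v z y : vector_fun R T,
    let vf := dsubmx (coef phi v) in
    let Pzf := drsubmx Pi *m dsubmx (coef zeta z) in
    let Cyf := drsubmx C *m dsubmx (coef psi y) in
     [/\ [/\ Rh cell VR v, Uh3 Omega cell VU z & Nh cell VN y],
         qc = vf + Pzf + Cyf
       & ip (diag_of S *m vf) vf + ip (S *m Pzf) Pzf + ip (S *m Cyf) Cyf
         <= c5 * ip (S *m qc) qc].
Proof.
move=> D S decomp q _ qc.
have Uzeta l : Uh3 Omega cell VU (zeta l) by have [] := hzeta.
have Npsi l : Nh cell VN (psi l) by have [] := hpsi.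
have phiC1 := basis_pwC1 hV hphi.
have D_sym : D^T = D := gram_sym.
have D_ge0 c : 0 <= ip (D *m c) c by rewrite (ip_gram hmesh phiC1) hdiv_ge0.
have Dii_unit : ulsubmx D \in unitmx.
  by apply: posdef_ulsubmx_unit => // c; exact: (ip_gram_eq0 hmesh phiC1 hphi).
have Pi0 := interpolation_matrix_dlsubmx hV hphi hdof Uzeta hzeta_split hPi.
have C0 := curl_matrix_dlsubmx hmesh hV hphi hdof Npsi hpsi_split hC.
(* qc is the coefficient vector chosen by coef; whether it is the only one does
   not matter. *)
pose u := discrete_extension (D := D) qc.
have Rh_u : Rh cell VR (lincomb phi u).
  by apply: subspace_lincomb; [exact: Rh_subspace hV|have [] := hphi].
have [v [z [y [[Rv Uz Ny] uE energy]]]] := decomp _ Rh_u.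
move: uE energy; rewrite (coef_lincomb _ hphi).
rewrite (energy_discrete_extension Dii_unit) => uE energy.
exists v, z, y; split => //.
  (* The sum becomes the interface part of the decomposition of [u], and the interface part of [u]
     is [qc]. *)
  rewrite -(dsubmx_mul_block_triangular _ Pi0).
  rewrite -(dsubmx_mul_block_triangular _ C0).
  by rewrite -!linearD -uE /= /u /discrete_extension col_mxKd.
(* Each of the three energies is at most its counterpart for the full vector. *)
apply: le_trans energy; rewrite !lerD//; first exact: schur_diag_le.
  rewrite -(dsubmx_mul_block_triangular _ Pi0).
  exact: schur_energy_le.
rewrite -(dsubmx_mul_block_triangular _ C0).
exact: schur_energy_le.
Qed.
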